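(* Let $n>2$ be an integer. The Lie algebra $\mathfrak{sl}(n,\mathbb{R})$ admits an overalgebra almost separating of degree $n$.
   Context: Let $G=SL(n,\mathbb{R})$, $\mathfrak g=\mathfrak{sl}(n,\mathbb{R})$; $\mathfrak g^\star$ is identified with $\mathfrak g$ by the invariant form $\langle X,Y\rangle=\mathrm{Tr}(XY)$, so that the coadjoint action $\mathrm{Coad}$ becomes conjugation. An element $\xi\in\mathfrak g^\star=\mathfrak{sl}(n,\mathbb{R})$ is called generic if it belongs to $\Omega=\{\xi\in\mathfrak{sl}(n,\mathbb{R}) : \xi \text{ has } n \text{ distinct complex eigenvalues}\}$. Given a finite-dimensional real linear representation $(\pi,V)$ of $G$, let $G^+=G\rtimes V$ be the Lie group with underlying set $G\times V$ and law $(g,v)(g',v')=(gg',v+\pi(g)v')$. Its Lie algebra is $\mathfrak g^+=\mathfrak g\rtimes V$, with bracket $[(X,u),(X',u')]=([X,X'],\pi'(X)u'-\pi'(X')u)$, where $\pi'$ is the derivative of $\pi$. One identifies $(\mathfrak g^+)^\star$ with $\mathfrak g^\star\oplus V^\star$. Let $p:(\mathfrak g^+)^\star\to\mathfrak g^\star$ be the canonical projection. An overalgebra almost separating of degree $d$ of $\mathfrak g$ is a pair $(\mathfrak g^+,\phi)$ where $\mathfrak g^+=\mathfrak g\rtimes V$ is the Lie algebra, with bracket $[(X,u),(X',u')]=([X,X'],\pi'(X)u'-\pi'(X')u)$, of the Lie group $G^+=G\rtimes V$ associated with some finite-dimensional real linear representation $(\pi,V)$ of $G$, and $\phi:\mathfrak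 g^\star\to V^\star$ is a polynomial map of degree $d$, such that the map $\Phi:\mathfrak g^\star\to(\mathfrak g^+)^\star$, $\Phi(\xi)=(\xi,\phi(\xi))$ (so $p\circ\Phi=\mathrm{id}$) satisfies: (i) $\Phi(\mathrm{Coad}(G)\xi)=\mathrm{Coad}(G^+)\Phi(\xi)$ for every $\xi\in\mathfrak g^\star$; (ii) for every generic $\xi$, the set of coadjoint orbits $\mathrm{Coad}(G)\xi'$, $\xi'\in\mathfrak g^\star$, such that $\overline{\mathrm{Conv}}\big(\Phi(\mathrm{Coad}(G)\xi')\big)=\overline{\mathrm{Conv}}\big(\Phi(\mathrm{Coad}(G)\xi)\big)$ is finite. Here $\overline{\mathrm{Conv}}$ denotes the closed convex hull. *)

(* Defs.v *)
From HB Require Import structures.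
From mathcomp Require Import all_boot all_order all_algebra.
From mathcomp Require Import complex.
From mathcomp Require mpoly.
Import (canonicals, coercions) mpoly.
From mathcomp Require Import all_classical all_reals all_analysis.

Set Implicit Arguments.
Unset Strict Implicit.
Unset Printing Implicit Defensive.

Import Order.TTheory GRing.Theory Num.Theory.
Import numFieldNormedType.Exports.

Local Open Scope classical_set_scope.
Local Open Scope ring_scope.

Section Definitions.
Variable R : realType.

Section SpecialLinear.
Variable n : nat.

Definition SL : set 'M[R]_n := [set g | \det g = 1].

Definition sl : set 'M[R]_n := [set X | \tr X = 0].

(* The dual of sl(n,R) is identified with sl(n,R) through <X,Y> = Tr (XY),
   so that the coadjoint action is conjugation. *)
Definition SL_orbit (xi : 'M[R]_n) : set 'M[R]_n :=
  [set g *m xi *m invmx g | g in SL].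

Definition generic (xi : 'M[R]_n) : Prop :=
  sl xi /\
  exists s : seq R[i],
    [/\ uniq s, size s = n &
        all (eigenvalue (map_mx (real_complex R) xi)) s].

Definition expm (X : 'M[R]_n) : 'M[R]_n :=
  limn (series (fun k : nat => (k`!%:R)^-1 *: X ^+ k)).

End SpecialLinear.

Section SemidirectProduct.
Variables n m : nat.

(* V = R^m is the space of columns, its dual the space of rows. *)

Definition is_representation (pi : 'M[R]_n -> 'M[R]_m) : Prop :=
  [/\ pi 1%:M = 1%:M,
      forall g h, SL g -> SL h -> pi (g *m h) = pi g *m pi h &
      {within @SL n, continuous pi}].

Definition rep_derivative (pi : 'M[R]_n -> 'M[R]_m) (X : 'M[R]_n) : 'M[R]_m :=
  derive1 (fun t : R => pi (expm (t *: X))) 0.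

(* Elements of G^+ = G |x V are the pairs (g, v) with g in SL. *)
Definition Gplus : set ('M[R]_n * 'cV[R]_m) := [set h | SL h.1].

Definition Gplus_mul (pi : 'M[R]_n -> 'M[R]_m) (h k : 'M[R]_n * 'cV[R]_m) :
  'M[R]_n * 'cV[R]_m := (h.1 *m k.1, h.2 + pi h.1 *m k.2).

Definition Gplus_inv (pi : 'M[R]_n -> 'M[R]_m) (h : 'M[R]_n * 'cV[R]_m) :
  'M[R]_n * 'cV[R]_m := (invmx h.1, - (pi (invmx h.1) *m h.2)).

Definition gplus : set ('M[R]_n * 'cV[R]_m) := [set Z | sl Z.1].

Definition gplus_bracket (pi : 'M[R]_n -> 'M[R]_m)
  (Z W : 'M[R]_n * 'cV[R]_m) : 'M[R]_n * 'cV[R]_m :=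
  (Z.1 *m W.1 - W.1 *m Z.1,
   rep_derivative pi Z.1 *m W.2 - rep_derivative pi W.1 *m Z.2).

(* Differential at the identity of the conjugation by h in G^+, computed along
   the curve t |-> (exp (tX), tu), whose velocity at t = 0 is Z = (X, u). *)
Definition Ad (pi : 'M[R]_n -> 'M[R]_m) (h Z : 'M[R]_n * 'cV[R]_m) :
  'M[R]_n * 'cV[R]_m :=
  derive1 (fun t : R =>
    Gplus_mul pi (Gplus_mul pi h (expm (t *: Z.1), t *: Z.2))
      (Gplus_inv pi h)) 0.

Definition gplus_dual : set ('M[R]_n * 'rV[R]_m) := [set l | sl l.1].

Definition pairing (l : 'M[R]_n * 'rV[R]_m) (Z : 'M[R]_n * 'cV[R]_m) : R :=
  \tr (l.1 *m Z.1) + (l.2 *m Z.2) 0 0.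

(* Coad h l = l o Ad (h^-1); the right-hand side determines l' because the
   pairing of gplus_dual with gplus is nondegenerate. *)
Definition Gplus_orbit (pi : 'M[R]_n -> 'M[R]_m) (l : 'M[R]_n * 'rV[R]_m) :
  set ('M[R]_n * 'rV[R]_m) :=
  [set l' | gplus_dual l' /\
     exists2 h, Gplus h &
       forall Z, gplus Z -> pairing l' Z = pairing l (Ad pi (Gplus_inv pi h) Z)].

(* Polynomial functions on the linear subspace sl are the restrictions of
   polynomials in the n * n matrix entries, the degree of such a function being
   the least degree of a polynomial restricting to it. *)
Definition polynomial_map_le (d : nat) (phi : 'M[R]_n -> 'rV[R]_m) : Prop :=
  forall j : 'I_m, exists p : mpoly.mpoly (n * n) R,
    (mpoly.mmeasure mpoly.mdeg p <= d.+1)%N /\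
    forall xi, sl xi -> phi xi 0 j = mpoly.meval (fun k => mxvec xi 0 k) p.

Definition polynomial_map_of_degree (d : nat) (phi : 'M[R]_n -> 'rV[R]_m) :
  Prop :=
  polynomial_map_le d phi /\
  forall e : nat, (e < d)%N -> ~ polynomial_map_le e phi.

End SemidirectProduct.

Definition closed_convex_hull (V : normedModType R) (A : set V) : set V :=
  smallest [set C : set V | closed C /\ convex_set C] A.

(* Overalgebra almost separating of degree d of sl(n,R), with V = R^m.
   The Lie algebra g^+ is given by its bracket br on gplus; the values of br
   and phi outside gplus and sl are irrelevant. *)
Definition overalgebra_almost_separating (n m d : nat)
  (br : 'M[R]_n * 'cV[R]_m -> 'M[R]_n * 'cV[R]_m -> 'M[R]_n * 'cV[R]_m)
  (phi : 'M[R]_n -> 'rV[R]_m) : Prop :=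
  let Phi := fun xi : 'M[R]_n => (xi, phi xi) in
  exists pi : 'M[R]_n -> 'M[R]_m,
  [/\ is_representation pi,
      forall Z W, gplus Z -> gplus W -> br Z W = gplus_bracket pi Z W,
      polynomial_map_of_degree d phi,
      forall xi, sl xi -> Phi @` SL_orbit xi = Gplus_orbit pi (Phi xi) &
      forall xi, generic xi ->
        finite_set [set O : set 'M[R]_n | exists xi' : 'M[R]_n,
          [/\ sl xi', O = SL_orbit xi' &
              closed_convex_hull (Phi @` SL_orbit xi')
              = closed_convex_hull (Phi @` SL_orbit xi)]]].

End Definitions.

(* Main.v *)
Require Import Defs.
From mathcomp Require Import all_boot all_order all_algebra.
From mathcomp Require Import perm complex.
From mathcomp Require mpoly.
Import (canonicals, coercions) mpoly.
From mathcomp Require Import all_classical all_reals all_analysis.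

(** Take [V = R^n] with the trivial representation.  Then [G^+] is the direct
product of [G] and [V], and [Ad (g, v)] sends [(X, u)] to [(g X g^-1, u)]
([Ad_trivial]), so that the coadjoint orbit of [(xi, f)] is the product of the
conjugacy orbit of [xi] with the point [f] ([Gplus_orbit_trivial]).  Therefore
[Phi] maps orbits onto orbits as soon as [phi] is constant on conjugacy classes.

For [phi] take the values of the characteristic polynomial of [xi] at the [n]
points [0, 1, ..., n-1].  These are polynomials of degree at most [n] in the
entries of [xi], invariant under conjugation, and they determine the
characteristic polynomial, which is monic of degree [n] ([char_values_inj]).
The first one is [det (- xi)]; on a line spanned by an invertible matrix of
trace zero it is a nonzero multiple of [t ^ n], hence the degree is exactly [n]
([char_values_not_lower_degree]).

For the finiteness, [Phi] maps an orbit into an affine subspace where the second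
component is constant.  Such a subspace is closed and convex, so that the closed
convex hull of the image remembers [phi xi] ([hull_orbit_invariant]), hence the
characteristic polynomial of [xi].  When [xi] has [n] distinct complex
eigenvalues, any real matrix with the same characteristic polynomial is similar
to [xi] over the complex numbers, hence over the reals ([similar_complex_real]).
The real matrices similar to [xi] form at most two [SL]-orbits, according to the
sign of the determinant of the conjugating matrix ([SL_orbits_of_similar]). *)

Set Implicit Arguments.
Unset Strict Implicit.
Unset Printing Implicit Defensive.
Import Order.TTheory GRing.Theory Num.Theory.
Import numFieldNormedType.Exports.
Local Open Scope classical_set_scope.
Local Open Scope ring_scope.

(** * Similarity of matrices with distinct eigenvalues *)

(** Eigenvectors [v i] for distinct eigenvalues [s i] are independent: if
[\sum_i u_i v_i = 0], then applying the powers of [A] gives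
[\sum_i s_i ^ k u_i v_i = 0] for all [k < n], and the Vandermonde matrix of [s]
is invertible. *)
Lemma eigenbasis_of_distinct_eigenvalues (F : fieldType) (n : nat)
    (A : 'M[F]_n) (s : seq F) :
  uniq s -> size s = n -> all (eigenvalue A) s ->
  exists2 P : 'M[F]_n, P \in unitmx &
    P *m A = diag_mx (\row_(i < n) s`_i) *m P.
Proof.
move=> s_uniq s_size s_eig.
have /fin_all_exists2[v vA v0] (i : 'I_n) :
    exists2 v : 'rV_n, v *m A = s`_i *: v & v != 0.
  by apply/eigenvalueP/(allP s_eig)/mem_nth; rewrite s_size.
pose d := \row_(i < n) s`_i.
pose P := \matrix_(i < n) v i.
have PA : P *m A = diag_mx d *m P.
  apply/row_matrixP => i; rewrite row_mul rowK vA.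
  by rewrite row_mul row_diag_mx -scalemxAl -rowE rowK !mxE.
exists P => //; rewrite -row_free_unit; apply: inj_row_free => u uP0.
have PAk k : P *m A ^+ k = diag_mx (\row_i s`_i ^+ k) *m P.
  elim: k => [|k IHk].
    rewrite expr0 mulmx1 (_ : \row_i _ = const_mx 1) ?diag_const_mx ?mul1mx //.
    by apply/rowP => i; rewrite !mxE expr0.
  rewrite exprSr -mulmxE mulmxA IHk -mulmxA PA mulmxA mulmx_diag.
  by congr (diag_mx _ *m P); apply/rowP => i; rewrite !mxE exprSr.
have WP0 : Vandermonde n d *m (diag_mx u *m P) = 0.
  apply/row_matrixP => k; rewrite row0.
  transitivity (u *m (P *m A ^+ k)).
    rewrite PAk row_mul !mulmxA; congr (_ *m P).
    by apply/rowP => j; rewrite !mul_mx_diag !mxE mulrC.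
  by rewrite mulmxA uP0 mul0mx.
have Vu : Vandermonde n d \in unitmx.
  rewrite unitmxE det_Vandermonde unitfE.
  apply/prodf_neq0 => i _; apply/prodf_neq0 => j ij.
  by rewrite !mxE subr_eq0 nth_uniq ?s_size // gtn_eqF.
have uP : diag_mx u *m P = 0 by rewrite -[LHS](mulKmx Vu) WP0 mulmx0.
apply/rowP => i; rewrite mxE; apply/eqP; move: (congr1 (row i) uP).
rewrite row_mul row_diag_mx -scalemxAl -rowE rowK row0 => /eqP.
by rewrite scaler_eq0 (negPf (v0 i)) orbF.
Qed.

Lemma similar_of_distinct_eigenvalues (F : fieldType) (n : nat)
    (A B : 'M[F]_n) (s : seq F) :
  uniq s -> size s = n -> all (eigenvalue A) s -> all (eigenvalue B) s ->
  exists2 P : 'M[F]_n, P \in unitmx & P *m A = B *m P.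
Proof.
move=> s_uniq s_size.
move=> /(eigenbasis_of_distinct_eigenvalues s_uniq s_size)[P Pu PA].
move=> /(eigenbasis_of_distinct_eigenvalues s_uniq s_size)[Q Qu QB].
exists (invmx Q *m P); first by rewrite unitmx_mul unitmx_inv Qu.
by rewrite -mulmxA PA -[X in _ = X *m _](mulKmx Qu) QB !mulmxA mulmxK.
Qed.

Lemma exists_nonroot (R : numDomainType) (p : {poly R}) :
  p != 0 -> exists t : R, ~~ root p t.
Proof.
move=> p0; apply: contrapT => noroot.
have proot x : root p x.
  by apply: contrapT => /negP px; apply: noroot; exists x.
have /(max_poly_roots p0) : all (root p) [seq i%:R | i <- iota 0 (size p)].
  exact/allP.
rewrite map_inj_uniq ?iota_uniq; last exact: mulrIn (oner_neq0 R).
by rewrite size_map size_iota ltnn => /(_ isT).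
Qed.

(** The real and imaginary parts [P1], [P2] of [P] both intertwine [A] and [B],
and so does [P1 + t P2] for every real [t].  The polynomial [det (P1 + t P2)]
does not vanish at [t = 'i], hence it does not vanish at some real [t]. *)
Lemma similar_complex_real (R : rcfType) (n : nat) (A B : 'M[R]_n)
    (P : 'M[R[i]]_n) :
  P \in unitmx ->
  P *m map_mx (real_complex R) A = map_mx (real_complex R) B *m P ->
  exists2 Q : 'M[R]_n, Q \in unitmx & Q *m A = B *m Q.
Proof.
move=> Pu PAB.
pose P1 := map_mx (@complex.Re R) P; pose P2 := map_mx (@complex.Im R) P.
have P1AB : P1 *m A = B *m P1.
  apply/matrixP => i j; have /matrixP/(_ i j)/(congr1 (@complex.Re R)) := PAB.
  rewrite !mxE !raddf_sum /= => Eij.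
  under eq_bigr do rewrite mxE; under [RHS]eq_bigr do rewrite mxE.
  etransitivity; last (etransitivity; first exact: Eij);
    apply: eq_bigr => k _; rewrite !mxE.
    by case: (P i k) => x y /=; rewrite mulr0 subr0.
  by case: (P k j) => x y /=; rewrite mul0r subr0.
have P2AB : P2 *m A = B *m P2.
  apply/matrixP => i j; have /matrixP/(_ i j)/(congr1 (@complex.Im R)) := PAB.
  rewrite !mxE !raddf_sum /= => Eij.
  under eq_bigr do rewrite mxE; under [RHS]eq_bigr do rewrite mxE.
  etransitivity; last (etransitivity; first exact: Eij);
    apply: eq_bigr => k _; rewrite !mxE.
    by case: (P i k) => x y /=; rewrite mulr0 add0r.
  by case: (P k j) => x y /=; rewrite mul0r addr0.
pose q := \det (map_mx polyC P1 + 'X *: map_mx polyC P2).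
have q0 : q != 0.
  apply: contraTneq Pu => q0; rewrite unitmxE unitfE negbK.
  have <- : (map_poly (real_complex R) q).[Complex 0 1] = \det P.
    rewrite /q -det_map_mx -horner_evalE -det_map_mx; congr (\det _).
    apply/matrixP => i j; rewrite !mxE /= rmorphD rmorphM /=.
    rewrite map_polyX !map_polyC /=.
    rewrite /horner_eval !hornerE /=; case: (P i j) => x y.
    by rewrite /= /real_complex_def; simpc.
  by rewrite q0 rmorph0 horner0.
have [t qt] := exists_nonroot q0.
exists (P1 + t *: P2).
  move: qt; rewrite /root unitmxE unitfE; congr (_ != 0).
  rewrite -horner_evalE -det_map_mx; congr (\det _).
  by apply/matrixP => i j; rewrite !mxE /= /horner_eval !hornerE.
by rewrite mulmxDl mulmxDr -scalemxAl -scalemxAr P1AB P2AB.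
Qed.

(** * The adjoint action for the trivial representation *)

Lemma cvg_mx_entries (R : realFieldType) (T : Type) (F : set_system T)
    (m n : nat) (f : T -> 'M[R]_(m, n)) (A : 'M[R]_(m, n)) :
  ProperFilter F ->
  (forall i j, f x i j @[x --> F] --> A i j) -> f x @[x --> F] --> A.
Proof.
move=> FF fA; apply/cvgrPdist_le => e e0; near=> x.
rewrite [leLHS]/Num.Def.normr/= mx_normrE (bigmax_le _ (ltW e0))//= => ij _.
rewrite !mxE.
move: ij; near: x; apply: filter_forall => /= -[i j].
exact: ((cvgrPdist_le _ _).1 (fA i j)).
Unshelve. all: by end_near. Qed.

Lemma cvg_mulmx_conj (R : realFieldType) (T : Type) (F : set_system T)
    (n : nat) (f : T -> 'M[R]_n) (A g h : 'M[R]_n) :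
  ProperFilter F ->
  f x @[x --> F] --> A -> g *m f x *m h @[x --> F] --> g *m A *m h.
Proof.
move=> FF fA; apply: cvg_mx_entries => i j.
rewrite mxE; under eq_fun do rewrite mxE.
apply: cvg_big => [|k _]; first exact: add_continuous.
apply: cvgMr_tmp; rewrite mxE; under eq_fun do rewrite mxE.
apply: cvg_big => [|l _]; first exact: add_continuous.
apply: cvgMl_tmp.
pose e (B : 'M[R]_n) := B l k.
exact: (cvg_comp f e fA (@coord_continuous _ _ _ l k A)).
Qed.

(** Coefficients of the exponential generating function of a sequence; they make
differentiation of the power series a shift of the sequence. *)
Definition egf (R : realType) (x : R^nat) : R^nat :=
  fun k => (k`!%:R)^-1 * x k.

(** Comparison with the exponential series of [M * `|z|]. *)
Lemma is_cvg_egf (R : realType) (x : R^nat) (M C z : R) :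
  0 <= M -> (forall k, `|x k| <= C * M ^+ k) -> cvgn (pseries (egf x) z).
Proof.
move=> M0 xM; have C0 : 0 <= C by rewrite -[C]mulr1 (le_trans _ (xM 0)).
apply: normed_cvg.
apply: (@series_le_cvg _ _ (C *: exp_coeff (M * `|z|))) => [k|k|k|] /=.
- exact: normr_ge0.
- by rewrite mulr_ge0// divr_ge0// exprn_ge0// mulr_ge0.
- rewrite !normrM normrX normfV normr_nat -mulrA mulrC fctE /exp_coeff/= exprMn.
  rewrite /GRing.scale/= !mulrA.
  by rewrite ler_wpM2r ?invr_ge0// ler_wpM2r ?exprn_ge0.
- exact/is_cvg_seriesZ/is_cvg_series_exp_coeff.
Qed.

Lemma pseries_diffs_egf (R : realType) (x : R^nat) :
  pseries_diffs (egf x) = egf (fun k => x k.+1).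
Proof.
apply/funext => k; rewrite /pseries_diffs /egf factS natrM invfM mulrA mulrA.
by rewrite divff ?mul1r.
Qed.

Lemma lim_pseries0 (R : realType) (c : R^nat) : limn (pseries c 0) = c 0.
Proof.
apply/cvg_lim => //; rewrite -(cvg_shiftS (pseries c 0)).
rewrite (_ : (fun _ => _) = cst (c 0)); first exact: cvg_cst.
apply/funext => k; rewrite /pseries/series/= big_nat_recl//.
rewrite expr0 mulr1 big1 ?addr0//.
by move=> i _; rewrite expr0n mulr0.
Qed.

Lemma norm_expr_mx_le (R : realType) (n : nat) (X : 'M[R]_n) (k : nat) i j :
  `|(X ^+ k) i j| <= (\sum_l \sum_p `|X l p|) ^+ k.
Proof.
elim: k i j => [|k IHk] i j.
  by rewrite !expr0 !mxE; case: eqP => _; rewrite ?normr1 ?normr0.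
rewrite !exprSr -mulmxE mxE (le_trans (ler_norm_sum _ _ _))// mulr_sumr.
apply: ler_sum => l _; rewrite normrM ler_pM//.
by rewrite (bigD1 j)//= lerDl sumr_ge0.
Qed.

Lemma expr_scalemx (R : comPzRingType) (n : nat) (a : R) (X : 'M[R]_n) k :
  (a *: X) ^+ k = a ^+ k *: X ^+ k.
Proof.
elim: k => [|k IHk]; first by rewrite !expr0 scale1r.
by rewrite !exprS IHk -!mulmxE -scalemxAl -scalemxAr scalerA.
Qed.

Lemma is_derive_pseries_egf0 (R : realType) (M C : R) (x : R^nat) :
  0 <= M -> (forall k, `|x k| <= C * M ^+ k) ->
  is_derive 0 (1 : R) (fun t => limn (pseries (egf x) t)) (x 1).
Proof.
move=> M0 xM.
have -> : x 1 = limn (pseries (pseries_diffs (egf x)) 0).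
  by rewrite pseries_diffs_egf lim_pseries0 /egf invr1 mul1r.
have xM1 k : `|x k.+1| <= C * M * M ^+ k by rewrite -mulrA -exprS.
have xM2 k : `|x k.+2| <= C * M * M * M ^+ k by rewrite -mulrA -exprS.
apply: (@pseries_snd_diffs _ _ 1); rewrite ?pseries_diffs_egf.
- exact: is_cvg_egf xM.
- exact: is_cvg_egf xM1.
- exact: is_cvg_egf xM2.
- by rewrite normr0 normr1.
Qed.

Lemma expm_entry (R : realType) (n : nat) (X : 'M[R]_n) (t : R) i j :
  expm (t *: X) i j = limn (pseries (egf (fun k => (X ^+ k) i j)) t).
Proof.
pose M := \sum_l \sum_p `|X l p|.
have M0 : 0 <= M by apply: sumr_ge0 => l _; apply: sumr_ge0.
pose c p q := egf (fun k => (X ^+ k) p q).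
have cc p q : cvgn (pseries (c p q) t).
  apply: (@is_cvg_egf _ (fun k => (X ^+ k) p q) M 1) => // k.
  by rewrite mul1r norm_expr_mx_le.
suff -> : expm (t *: X) = \matrix_(p, q) limn (pseries (c p q) t).
  by rewrite mxE.
apply/cvg_lim => //; apply: cvg_mx_entries => p q; rewrite mxE.
rewrite (_ : (fun _ => _) = pseries (c p q) t); first exact: cc.
apply/funext => N; rewrite /series /pseries/= summxE; apply: eq_bigr => k _.
by rewrite expr_scalemx !mxE /c /egf mulrA mulrAC.
Qed.

(** Each entry of [expm (t *: X)] is a power series in [t] with infinite radius
of convergence, whose derivative at [0] is its coefficient of degree one. *)
Lemma expm_velocity (R : realType) (n : nat) (X : 'M[R]_n) :
  h^-1 *: (expm (h *: X) - expm (0 *: X)) @[h --> (0 : R)^'] --> X.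
Proof.
pose M := \sum_l \sum_p `|X l p|.
have M0 : 0 <= M by apply: sumr_ge0 => l _; apply: sumr_ge0.
apply: cvg_mx_entries => i j.
have XM k : `|(X ^+ k) i j| <= 1 * M ^+ k by rewrite mul1r norm_expr_mx_le.
have [/cvg_ex[l Dl] Dx] := is_derive_pseries_egf0 M0 XM.
rewrite /derive (cvg_lim _ Dl)// expr1 in Dx; rewrite Dx in Dl.
under eq_fun do rewrite !mxE !expm_entry.
apply: cvg_trans Dl; apply: near_eq_cvg; near=> h => /=.
by rewrite addr0 [h%:A]mulr1.
Unshelve. all: by end_near. Qed.

(** Conjugation fixes the factor [V]: as [V] is abelian, the curve
[(exp (t X), t u)] is sent to [(g exp (t X) g^-1, t u)]. *)
Lemma Ad_trivial (R : realType) (n m : nat) (h Z : 'M[R]_n * 'cV[R]_m) :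
  Ad (fun _ => 1%:M) h Z = (h.1 *m Z.1 *m invmx h.1, Z.2).
Proof.
pose V := ('M[R]_n * 'cV[R]_m)%type : normedModType R.
rewrite /Ad /derive1; apply: (cvg_lim (@norm_hausdorff _ V)).
pose q (t : R) :=
  h.1 *m (t^-1 *: (expm (t *: Z.1) - expm (0 *: Z.1))) *m invmx h.1.
pose r (t : R) := t^-1 *: (t *: Z.2).
rewrite [X in X @ _ --> _](_ : _ = fun t => (q t, r t)); last first.
  apply/funext => t; rewrite addr0.
  have -> (a b : 'M[R]_n * 'cV[R]_m) :
    t^-1 *: (a - b) = (t^-1 *: (a.1 - b.1), t^-1 *: (a.2 - b.2)) by [].
  congr (_, _) => /=.
    by rewrite -mulmxBl -mulmxBr /q -scalemxAr -scalemxAl.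
  by rewrite !mul1mx scale0r addr0 subrr subr0 addrAC subrr add0r.
apply: (@cvg_pair _ _ _ _ (nbhs (h.1 *m Z.1 *m invmx h.1)) (nbhs Z.2)
          _ _ _ q r).
  by apply: cvg_mulmx_conj; exact: expm_velocity.
apply: cvg_near_cst.
near=> t; rewrite /r scalerA mulVf ?scale1r//.
by near: t; exact: nbhs_dnbhs_neq.
Unshelve. all: by end_near. Qed.

(** * Values of the characteristic polynomial *)

Lemma msize_prod_le (N : nat) (R : idomainType) (I : finType)
    (F : I -> mpoly.mpoly N R) :
  (forall i, mpoly.mmeasure mpoly.mdeg (F i) <= 2)%N ->
  (mpoly.mmeasure mpoly.mdeg (\prod_i F i) <= #|I|.+1)%N.
Proof.
move=> F2; rewrite cardE -big_enum; elim: (enum I) => [|i r IHr].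
  by rewrite big_nil mpoly.mmeasure1.
rewrite big_cons; set q := \big[_/_]_(_ <- _) _.
change (mpoly.mmeasure mpoly.mdeg (F i * q) <= (size (i :: r)).+1)%N.
have [->|Fi0] := eqVneq (F i) 0; first by rewrite mul0r mpoly.mmeasure0.
have [->|q0] := eqVneq q 0; first by rewrite mulr0 mpoly.mmeasure0.
rewrite mpoly.msizeM//= -subn1 leq_subLR.
exact: leq_add (F2 i) IHr.
Qed.

(** Expand the determinant: each term is a product of [n] factors of degree at
most one.  The measure [mmeasure mdeg] is one more than the degree. *)
Lemma msize_det_le (N : nat) (R : idomainType) (n : nat)
    (A : 'M[mpoly.mpoly N R]_n) :
  (forall i j, mpoly.mmeasure mpoly.mdeg (A i j) <= 2)%N ->
  (mpoly.mmeasure mpoly.mdeg (\det A) <= n.+1)%N.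
Proof.
move=> A2; rewrite (leq_trans (mpoly.mmeasure_sum _ _ _ _))//.
apply/bigmax_leqP => s _; rewrite -signr_odd.
suff h : (mpoly.mmeasure mpoly.mdeg (\prod_i A i (s i)) <= n.+1)%N.
  by case: (odd _); rewrite ?expr1 ?expr0 ?mulN1r ?mul1r ?mpoly.mmeasureN.
by rewrite (leq_trans (msize_prod_le _))// card_ord.
Qed.

Definition char_values (R : comNzRingType) (n : nat) (xi : 'M[R]_n) :
  'rV[R]_n :=
  \row_(j < n) \det (j%:R%:M - xi).

Lemma char_values_polynomial (R : realType) (n : nat) :
  polynomial_map_le n (@char_values R n).
Proof.
move=> j.
pose G : 'M[mpoly.mpoly (n * n) R]_n :=
  \matrix_(i, k) mpoly.mpolyX R (mpoly.mnm1 (mxvec_index i k)).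
exists (\det ((mpoly.mpolyC _ j%:R)%:M - G)); split.
  apply: msize_det_le => i k; rewrite !mxE.
  rewrite (leq_trans (mpoly.mmeasureD_le _ _ _))// geq_max mpoly.mmeasureN.
  rewrite mpoly.mmeasureX /= mpoly.mdeg1 andbT.
  case: (i == k); last by rewrite mulr0n mpoly.mmeasure0.
  by rewrite mulr1n mpoly.mmeasureC; case: eqP.
move=> xi _; rewrite mxE -det_map_mx; congr (\det _).
apply/matrixP => i k; rewrite !mxE /= mpoly.mevalB mpoly.mevalXU mxvecE.
by rewrite mpoly.mevalMn mpoly.mevalC.
Qed.

Lemma polynomial_on_line (R : idomainType) (N e : nat) (p : mpoly.mpoly N R)
    (v : 'I_N -> R) :
  (mpoly.mmeasure mpoly.mdeg p <= e)%N ->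
  exists2 q : {poly R}, (size q <= e)%N &
    forall t, q.[t] = mpoly.meval (fun k => t * v k) p.
Proof.
move=> pe.
exists (\sum_(m <- mpoly.msupp p)
   (mpoly.mcoeff m p * \prod_i v i ^+ mpoly.fun_of_multinom m i)
     *: 'X^(mpoly.mdeg m)).
  rewrite big_seq (leq_trans (size_sum _ _ _))//.
  apply/bigmax_leqP_seq => m mp mp'.
  rewrite (leq_trans (size_scale_leq _ _))// size_polyXn (leq_trans _ pe)//.
  exact: mpoly.msize_mdeg_lt.
move=> t; rewrite horner_sum mpoly.mevalE; apply: eq_bigr => m _.
rewrite !hornerE -mulrA; congr (_ * _); rewrite mpoly.mdegE.
rewrite -prodrXr -big_split/=; apply: eq_bigr => i _.
by rewrite exprMn mulrC.
Qed.

(** At [t D] with [D] of trace zero, the first coordinate is [det (- t D)], which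
is [t ^ n] times the nonzero number [det (- D)]; a polynomial of degree at most [e]
restricts to a polynomial of degree at most [e] in [t]. *)
Lemma char_values_not_lower_degree (R : realType) (n e : nat) :
  (1 < n)%N -> (e < n)%N -> ~ polynomial_map_le e (@char_values R n).
Proof.
case: n => // n n1 en /(_ ord0)[p [pe pE]].
pose D : 'M[R]_n.+1 := diag_mx (\row_i if i == ord0 then - n%:R else 1).
have D0 : \tr D = 0.
  rewrite mxtrace_diag big_ord_recl mxE eqxx (eq_bigr (fun=> 1)).
    by rewrite sumr_const card_ord addNr.
  by move=> i _; rewrite mxE.
have detD : \det D != 0.
  rewrite det_diag; apply/prodf_neq0 => i _; rewrite mxE.
  case: ifP => _; last exact: oner_neq0.
  by rewrite oppr_eq0 pnatr_eq0 -lt0n.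
have [q qe qE] := polynomial_on_line (fun k => mxvec D 0 k) pe.
have qX : q = (\det (- D)) *: 'X^(n.+1).
  apply/eqP; rewrite -subr_eq0; apply/negPn/negP => /exists_nonroot[t].
  case/negP; rewrite /root !hornerE qE subr_eq0; apply/eqP.
  transitivity (char_values (t *: D) 0 ord0).
    rewrite pE; last by rewrite /sl/= mxtraceZ D0 mulr0.
    by apply: mpoly.meval_eq => k; rewrite linearZ mxE.
  by rewrite mxE /= raddf0 sub0r -scalerN detZ mulrC.
have detND : \det (- D) != 0.
  by rewrite -scaleN1r detZ mulf_neq0// expf_neq0// oppr_eq0 oner_neq0.
by move: qe; rewrite qX size_scale// size_polyXn ltnS leqNgt en.
Qed.

Lemma horner_char_poly (R : comNzRingType) (n : nat) (A : 'M[R]_n) (a : R) :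
  (char_poly A).[a] = \det (a%:M - A).
Proof.
rewrite -horner_evalE -det_map_mx; congr (\det _); apply/matrixP => i j.
by rewrite !mxE /= /horner_eval !hornerE hornerMn hornerX.
Qed.

(** Both polynomials are monic of degree [n], so their difference has degree
less than [n] and cannot vanish at [0, 1, ..., n-1] unless it is zero. *)
Lemma char_values_inj (R : numDomainType) (n : nat) (A B : 'M[R]_n) :
  char_values A = char_values B -> char_poly A = char_poly B.
Proof.
move=> AB; apply/eqP; rewrite -subr_eq0; apply/negPn/negP.
set p : {poly R} := _ - _ => p0.
have size_p : (size p <= n)%N.
  apply/leq_sizeP => i; rewrite coefB leq_eqVlt => /predU1P[<-|ni].
    have lead1 (C : 'M[R]_n) : (char_poly C)`_n = 1.
      by have /monicP := char_poly_monic C; rewrite lead_coefE size_char_poly.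
    by rewrite !lead1 subrr.
  by rewrite !nth_default ?subrr// size_char_poly.
pose r : seq R := [seq i%:R | i <- iota 0 n].
have : all (root p) r.
  apply/allP => _ /mapP[j + ->]; rewrite mem_iota add0n /= => jn.
  rewrite /root hornerD hornerN !horner_char_poly subr_eq0; apply/eqP.
  by move/rowP: AB => /(_ (Ordinal jn)); rewrite !mxE.
move=> /(max_poly_roots p0).
rewrite map_inj_uniq ?iota_uniq; last exact: mulrIn (oner_neq0 R).
by rewrite size_map size_iota ltnNge size_p => /(_ isT).
Qed.

Lemma char_values_conj (R : comUnitRingType) (n : nat) (g A : 'M[R]_n) :
  g \in unitmx -> char_values (g *m A *m invmx g) = char_values A.
Proof.
move=> gu; apply/rowP => j; rewrite !mxE.
rewrite -[in LHS](mulmxK gu j%:R%:M) -[_ *m g]scalar_mxC.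
by rewrite -mulmxBl -mulmxBr !det_mulmx det_inv mulrAC mulrV ?mul1r -?unitmxE.
Qed.

(** * Conjugation orbits of SL(n, R) *)

Lemma SL_unitmx (R : realType) (n : nat) (g : 'M[R]_n) : SL g -> g \in unitmx.
Proof. by rewrite /SL/= unitmxE => ->; rewrite unitr1. Qed.

Lemma SL_invmx (R : realType) (n : nat) (g : 'M[R]_n) : SL g -> SL (invmx g).
Proof. by rewrite /SL/= det_inv => ->; rewrite invr1. Qed.

Lemma SL_mulmx (R : realType) (n : nat) (g h : 'M[R]_n) :
  SL g -> SL h -> SL (g *m h).
Proof. by rewrite /SL/= det_mulmx => -> ->; rewrite mulr1. Qed.

Lemma invmxM (R : comUnitRingType) (n : nat) (g h : 'M[R]_n) :
  g \in unitmx -> h \in unitmx -> invmx (g *m h) = invmx h *m invmx g.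
Proof.
move=> gu hu; have ghu : g *m h \in unitmx by rewrite unitmx_mul gu.
apply: (can_inj (mulmxK ghu)).
by rewrite mulVmx// -!mulmxA (mulmxA (invmx g)) mulVmx// mul1mx mulVmx.
Qed.

Lemma SL_orbit_conj (R : realType) (n : nat) (g A : 'M[R]_n) :
  SL g -> SL_orbit (g *m A *m invmx g) = SL_orbit A.
Proof.
move=> gSL; have gu := SL_unitmx gSL; apply/seteqP; split=> _ [h hSL <-].
  exists (h *m g); first exact: SL_mulmx.
  by rewrite invmxM ?SL_unitmx// !mulmxA.
exists (h *m invmx g); first exact/SL_mulmx/SL_invmx.
rewrite invmxM ?SL_unitmx//; last exact: SL_invmx.
by rewrite invmxK !mulmxA !mulmxKV.
Qed.

(** Scaling [g] by the [n]-th root of [(det g)^-1] brings it into [SL] and does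
not change the conjugate. *)
Lemma SL_orbit_conj_det_gt0 (R : realType) (n : nat) (g A : 'M[R]_n) :
  0 < \det g -> SL_orbit (g *m A *m invmx g) = SL_orbit A.
Proof.
move=> g0; have [n0|n0] := posnP n.
  congr SL_orbit; apply/matrixP => i; have := ltn_ord i; rewrite {2}n0//.
have n0' : n%:R != 0 :> R by rewrite pnatr_eq0 -lt0n.
pose a := \det g `^ (- n%:R^-1).
have a0 : a != 0 by rewrite gt_eqF// powR_gt0.
have gu : g \in unitmx by rewrite unitmxE unitfE gt_eqF.
have ag : SL (a *: g).
  rewrite /SL/= detZ -powR_mulrn ?powR_ge0// -powRrM mulNr mulVf//.
  by rewrite powR_inv1 ?ltW// mulVf ?gt_eqF.
rewrite -(SL_orbit_conj A ag); congr SL_orbit.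
rewrite invmxZ ?SL_unitmx//.
by rewrite -!scalemxAl -scalemxAr scalerA mulfV// scale1r.
Qed.

(** A conjugating matrix of positive determinant can be scaled into [SL]; one of
negative determinant can be so after composition with a fixed reflection [E]. *)
Lemma SL_orbits_of_similar (R : realType) (n : nat) (A : 'M[R]_n) :
  exists A', forall B g, g \in unitmx -> g *m A = B *m g ->
    SL_orbit B = SL_orbit A \/ SL_orbit B = SL_orbit A'.
Proof.
have [n0|n0] := posnP n.
  exists A => B g _ _; left; congr SL_orbit.
  by apply/matrixP => i; have := ltn_ord i; rewrite {2}n0.
pose E : 'M[R]_n := diag_mx (\row_i if i == Ordinal n0 then - 1 else 1).
have detE : \det E = - 1.
  rewrite det_diag (bigD1 (Ordinal n0))//= mxE eqxx big1 ?mulr1// => i.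
  by rewrite mxE => /negPf ->.
have Eu : E \in unitmx by rewrite unitmxE detE unitrN1.
exists (E *m A *m invmx E) => B g gu gA.
have -> : B = g *m A *m invmx g by rewrite gA mulmxK.
have : \det g != 0 by rewrite -unitfE -unitmxE.
rewrite neq_lt => /orP[g0|g0]; last by left; exact: SL_orbit_conj_det_gt0.
right; rewrite -(@SL_orbit_conj_det_gt0 _ _ (g *m invmx E) (E *m A *m invmx E)).
  congr SL_orbit; rewrite invmxM ?unitmx_inv// invmxK.
  by rewrite !mulmxA !mulmxKV.
by rewrite det_mulmx det_inv detE invrN1 mulrN1 oppr_gt0.
Qed.

Lemma SL_orbits_of_char_poly (R : realType) (n : nat) (A : 'M[R]_n) :
  generic A ->
  exists A', forall B, char_poly B = char_poly A ->
    SL_orbit B = SL_orbit A \/ SL_orbit B = SL_orbit A'.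
Proof.
move=> [_ [s [s_uniq s_size sA]]].
have [A' A'P] := SL_orbits_of_similar A; exists A' => B BA.
have sB : all (eigenvalue (map_mx (real_complex R) B)) s.
  apply/allP => z /(allP sA).
  by rewrite !eigenvalue_root_char -!map_char_poly BA.
have [P Pu PAB] := similar_of_distinct_eigenvalues s_uniq s_size sA sB.
have [Q Qu QAB] := similar_complex_real Pu PAB.
exact: A'P Qu QAB.
Qed.

(** * Orbits and closed convex hulls in the dual of the overalgebra *)

Lemma closed_convex_snd_fiber (R : realType) (V W : normedModType R) (f : W) :
  closed [set x : V * W | x.2 = f] /\ convex_set [set x : V * W | x.2 = f].
Proof.
split.
  apply: (@preimage_closed _ _ (@snd V W) [set f]).
    by move=> x _; exact: cvg_snd.
  exact/accessible_closed_set1/hausdorff_accessible/norm_hausdorff.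
move=> x y l; rewrite !inE/= => xf yf.
by rewrite xf yf -scalerDl /unstable.onem addrCA subrr addr0 scale1r.
Qed.

Lemma mxtrace_mul_tr_eq0 (R : realDomainType) (m n : nat) (C : 'M[R]_(m, n)) :
  \tr (C *m C^T) = 0 -> C = 0.
Proof.
have -> : \tr (C *m C^T) = \sum_i \sum_j C i j ^+ 2.
  apply: eq_bigr => i _; rewrite mxE; apply: eq_bigr => j _.
  by rewrite [C^T j i]mxE expr2.
move=> C0; apply/matrixP => i j; rewrite [RHS]mxE; apply/eqP.
rewrite -sqrf_eq0; apply/eqP.
have Ci := psumr_eq0P (fun i _ => sumr_ge0 _ (fun j _ => sqr_ge0 (C i j))) C0.
exact: (psumr_eq0P (fun j _ => sqr_ge0 (C i j)) (Ci i isT)).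
Qed.

(** The fiber [x.2 = phi A] is closed and convex and contains the image of the
orbit of [A], hence it contains the hull, to which [Phi B] belongs. *)
Lemma hull_orbit_invariant (R : realType) (n m : nat)
    (phi : 'M[R]_n -> 'rV[R]_m) (A B : 'M[R]_n) :
  let Phi := fun xi => (xi, phi xi) in
  (forall g xi, g \in unitmx -> phi (g *m xi *m invmx g) = phi xi) ->
  closed_convex_hull (Phi @` SL_orbit B)
    = closed_convex_hull (Phi @` SL_orbit A) ->
  phi B = phi A.
Proof.
move=> Phi phi_conj BA.
have : closed_convex_hull (Phi @` SL_orbit B) (Phi B).
  apply: sub_gen_smallest; exists B => //; exists 1%:M; first exact: det1.
  by rewrite invmx1 mul1mx mulmx1.
rewrite BA => /(_ [set x | x.2 = phi A]); apply.
split; first exact: closed_convex_snd_fiber.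
by move=> _ [_ [g gSL <-] <-] /=; rewrite phi_conj// SL_unitmx.
Qed.

(** Membership in the right-hand side says that two linear forms agree on
[gplus]: their [V] components are read off on [(0, delta_mx j 0)], and a trace
zero matrix [C] orthogonal to [C^T] vanishes. *)
Lemma Gplus_orbit_trivial (R : realType) (n m : nat)
    (phi : 'M[R]_n -> 'rV[R]_m) (A : 'M[R]_n) :
  let Phi := fun xi => (xi, phi xi) in
  (forall g xi, g \in unitmx -> phi (g *m xi *m invmx g) = phi xi) ->
  sl A ->
  Phi @` SL_orbit A = Gplus_orbit (fun _ => 1%:M) (Phi A).
Proof.
move=> Phi phi_conj A0; apply/seteqP; split.
  move=> _ [_ [g gSL <-] <-].
  have gu := SL_unitmx gSL.
  split; first by rewrite /gplus_dual/sl/= mxtrace_mulC mulKmx.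
  exists (g, 0) => // Z _.
  rewrite Ad_trivial /pairing/= invmxK phi_conj//; congr (_ + _).
  by rewrite -!mulmxA mxtrace_mulC -!mulmxA.
move=> [B f] [/= B0 [[g v] /= gSL BZ]].
have gu : g \in unitmx by exact: SL_unitmx.
have fE : f = phi A.
  apply/rowP => j.
  have /BZ : gplus (0 : 'M[R]_n, delta_mx j 0 : 'cV[R]_m).
    by rewrite /gplus/sl/= mxtrace0.
  rewrite Ad_trivial /pairing/= !(mulmx0, mul0mx) !mxtrace0 !add0r.
  by rewrite -!colE !mxE.
have BE : B = g *m A *m invmx g.
  apply/eqP; rewrite -subr_eq0; apply/eqP.
  set C := B - _.
  have C0 : \tr C = 0.
    by rewrite /C linearB/= B0 mxtrace_mulC mulKmx// A0 subrr.
  have : \tr (C *m C^T) = 0.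
    have /BZ : gplus (C^T, 0 : 'cV[R]_m) by rewrite /gplus/sl/= mxtrace_tr.
    rewrite Ad_trivial /pairing/= !mulmx0 mxE !addr0 invmxK => BC.
    rewrite {1}/C mulmxBl linearB/= BC; apply/eqP; rewrite subr_eq0.
    by rewrite -!mulmxA [eqbRHS]mxtrace_mulC -!mulmxA.
  exact: mxtrace_mul_tr_eq0.
exists B; first by exists g.
by rewrite /Phi fE BE phi_conj.
Qed.

Theorem corollary3p5 (R : realType) (n : nat) (hn : (2 < n)%N) :
  exists (m : nat)
    (br : 'M[R]_n * 'cV[R]_m -> 'M[R]_n * 'cV[R]_m -> 'M[R]_n * 'cV[R]_m)
    (phi : 'M[R]_n -> 'rV[R]_m),
    overalgebra_almost_separating n br phi.
Proof.
pose pi (g : 'M[R]_n) : 'M[R]_n := 1%:M.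
exists n, (gplus_bracket pi), (@char_values R n), pi.
have chi_conj := @char_values_conj R n.
split => //.
- split=> // [g h _ _|]; first by rewrite /pi mulmx1.
  apply: continuous_subspaceT; exact: cst_continuous.
- split; first exact: char_values_polynomial.
  by move=> e en; apply: char_values_not_lower_degree => //; exact: ltnW.
- by move=> xi; exact: Gplus_orbit_trivial.
- move=> xi /SL_orbits_of_char_poly[xi' xi'P].
  apply: (@sub_finite_set _ _ [set SL_orbit xi; SL_orbit xi']);
    last exact: finite_set2.
  move=> _ [B [_ -> /(hull_orbit_invariant chi_conj)/char_values_inj/xi'P]].
  by case=> ->; [left|right].
Qed.
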